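(* Let $G$ be a group, $N$ a normal subgroup of $G$, $i:N\hookrightarrow G$ the inclusion map, and $\Gamma=G/N$. Assume that the following two conditions hold. (a) $\mathrm{H}^3_b(\Gamma)$ is finite-dimensional. (b) Either $\mathrm{H}^2_b(\Gamma)$ or $\mathrm{H}^2(\Gamma)$ is finite-dimensional. Then $\widehat{i^*}(\mathrm{Q}(G)/\mathrm{H}^1(G))$ is norm-closed in $(\mathrm{Q}(N)^G/\mathrm{H}^1(N)^G,D_N)$.
   Context: $\mathrm{H}^n(\cdot)$ and $\mathrm{H}^n_b(\cdot)$ denote ordinary and bounded group cohomology with trivial real coefficients: $\mathrm{C}^n(\Gamma)$ is the space of functions $\Gamma^n\to\mathbb{R}$ with the usual inhomogeneous coboundary $\delta$, $\mathrm{H}^n(\Gamma)$ is its cohomology, and $\mathrm{H}^n_b(\Gamma)$ is the cohomology of the subcomplex $\mathrm{C}^n_b(\Gamma)$ of bounded functions. Dimensions are over $\mathbb{R}$. For a group $H$ and $f:H\to\mathbb{R}$, the defect is $D_H(f)=\sup\{|f(h_1h_2)-f(h_1)-f(h_2)| : h_1,h_2\in H\}$; $f$ is a quasimorphism if $D_H(f)<\infty$, and homogeneous if its restriction to every cyclic subgroup is a homomorphism. $\mathrm{Q}(H)$ is the real vector space of homogeneous quasimorphisms on $H$; $\mathrm{H}^1(H)=\mathrm{Hom}(H,\mathbb{R})$. $\mathrm{Q}(N)^G$ and $\mathrm{H}^1(N)^G$ are the subspaces of $\mathrm{Q}(N)$ and $\mathrm{H}^1(N)$ of elements invariant under conjugation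 by $G$. The defect $D_N$ induces a norm, also written $D_N$, on $\mathrm{Q}(N)^G/\mathrm{H}^1(N)^G$. The map $\widehat{i^*}:\mathrm{Q}(G)/\mathrm{H}^1(G)\to\mathrm{Q}(N)^G/\mathrm{H}^1(N)^G$ is $[\phi]\mapsto[\phi|_N]$. *)

(* Defs.v *)
From HB Require Import structures.
From mathcomp Require Import all_boot all_order all_algebra.
From mathcomp Require Import all_classical all_reals all_analysis.
From mathcomp Require Import ring lra.

Set Implicit Arguments.
Unset Strict Implicit.
Unset Printing Implicit Defensive.

Import Order.TTheory GRing.Theory Num.Theory.
Import numFieldNormedType.Exports.

Local Open Scope classical_set_scope.
Local Open Scope quotient_scope.
Local Open Scope ring_scope.

HB.mixin Record isNormalSubgroup (G : groupType) (S : {pred G}) := {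
  gpredJr : forall x g, x \in S -> (x ^ g)%g \in S
}.

#[short(type="normalSubgroup")]
HB.structure Definition NormalSubgroup (G : groupType) :=
  {S of GroupClosed G S & isNormalSubgroup G S}.

Section SubgroupType.
Variables (G : groupType) (N : groupClosed G).

Definition subgroup := {x : G | x \in N}.

HB.instance Definition _ := SubChoice.on subgroup.

Lemma subgroup_closed : group_closed (fun x : G => x \in N).
Proof. by split; [exact: gpred1|move=> x y; exact: gpredF]. Qed.

HB.instance Definition _ := SubChoice_isSubGroup.Build G _ subgroup
  subgroup_closed.

End SubgroupType.

Section Conjugation.
Variables (G : groupType) (N : normalSubgroup G).

Definition subgroup_conj (x : subgroup N) (g : G) : subgroup N :=
  Sub (val x ^ g)%g (gpredJr _ g (valP x)).

End Conjugation.

Section QuotientGroup.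
Variables (G : groupType) (N : normalSubgroup G).

Definition coset_equiv (x y : G) := (x^-1 * y)%g \in N.

Lemma coset_equiv_is_equiv : equiv_class_of coset_equiv.
Proof.
split=> [x|x y|y x z]; rewrite /coset_equiv.
- by rewrite mulVg gpred1.
- by rewrite -gpredV invgM invgK.
- move=> xy yz; have -> : (x^-1 * z = (x^-1 * y) * (y^-1 * z))%g.
    by rewrite -mulgA mulVKg.
  exact: gpredM.
Qed.

Canonical coset_equiv_equiv := EquivRelPack coset_equiv_is_equiv.
Canonical coset_equiv_encModRel := defaultEncModRel coset_equiv.

Definition quotient_group := {eq_quot coset_equiv}.

HB.instance Definition _ : EqQuotient G coset_equiv quotient_group :=
  EqQuotient.on quotient_group.
HB.instance Definition _ := Choice.on quotient_group.

Local Notation Q := quotient_group.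

Let mulq : Q -> Q -> Q := lift_op2 Q *%g.
Let invq : Q -> Q := lift_op1 Q (fun x : G => x^-1)%g.
Let oneq : Q := lift_cst Q 1%g.

Lemma coset_eqP (x y : G) : reflect (\pi_Q x = \pi_Q y) ((x^-1 * y)%g \in N).
Proof. exact: (@eqquotP _ _ Q x y). Qed.

Lemma coset_repr (x : G) : (x^-1 * repr (\pi_Q x))%g \in N.
Proof. by apply/coset_eqP; rewrite reprK. Qed.

Lemma pi_mulq : {morph \pi_Q : x y / (x * y)%g >-> mulq x y}.
Proof.
move=> x y; unlock mulq; apply/coset_eqP.
set x' := repr _; set y' := repr _.
have -> : ((x * y)^-1 * (x' * y') = (y^-1 * y') * ((x^-1 * x') ^ y'))%g.
  by rewrite conjgE invgM -!mulgA !mulVKg.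
by apply: gpredM; [|apply: gpredJr]; apply: coset_repr.
Qed.

Lemma pi_invq : {morph \pi_Q : x / (x^-1)%g >-> invq x}.
Proof.
move=> x; unlock invq; apply/coset_eqP.
set x' := repr _.
have -> : (x^-1^-1 * x'^-1 = ((x^-1 * x')^-1) ^ x^-1)%g.
  by rewrite conjgE invgM !invgK -!mulgA mulgV mulg1.
by apply: gpredJr; rewrite gpredV coset_repr.
Qed.

Lemma pi_oneq : \pi_Q 1%g = oneq.
Proof. by unlock oneq. Qed.

Let mulqA : associative mulq.
Proof.
move=> x y z; rewrite -[x]reprK -[y]reprK -[z]reprK.
by rewrite -!pi_mulq mulgA.
Qed.
Let mul1q : left_id oneq mulq.
Proof. by move=> x; rewrite -[x]reprK -pi_oneq -pi_mulq mul1g. Qed.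
Let mulq1 : right_id oneq mulq.
Proof. by move=> x; rewrite -[x]reprK -pi_oneq -pi_mulq mulg1. Qed.
Let mulVq : left_inverse oneq invq mulq.
Proof. by move=> x; rewrite -[x]reprK -pi_oneq -pi_invq -pi_mulq mulVg. Qed.
Let mulqV : right_inverse oneq invq mulq.
Proof. by move=> x; rewrite -[x]reprK -pi_oneq -pi_invq -pi_mulq mulgV. Qed.

HB.instance Definition _ := isGroup.Build quotient_group
  mulqA mul1q mulq1 mulVq mulqV.

Lemma pi_mulg : {morph \pi_Q : x y / (x * y)%g}.
Proof. exact: pi_mulq. Qed.

End QuotientGroup.

Section QuotientSpace.
Variables (R : pzRingType) (V : lmodType R) (W : submodClosed V).

(* quot expects a zmodClosed, which a submodClosed does not coerce to *)
Definition submod_zmod_pred : {pred V} := W.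

HB.instance Definition _ := GRing.isZmodClosed.Build V submod_zmod_pred
  (GRing.submod_closedB (GRing.submodClosedP W)).

Definition quotient_space := Quotient.quot submod_zmod_pred.

HB.instance Definition _ := GRing.Zmodule.on quotient_space.
HB.instance Definition _ :
  EqQuotient V (Quotient.equiv submod_zmod_pred) quotient_space :=
  EqQuotient.on quotient_space.

Local Notation Q := quotient_space.

Let scaleq (a : R) : Q -> Q := lift_op1 Q ( *:%R a).

Lemma quotient_eqP (x y : V) : reflect (\pi_Q x = \pi_Q y) (x - y \in W).
Proof. exact: (@eqquotP _ _ Q x y). Qed.

Lemma pi_addq : {morph \pi_Q : x y / x + y}.
Proof. exact: Quotient.pi_add. Qed.

Let pi_scaleq a : {morph \pi_Q : x / a *: x >-> scaleq a x}.
Proof.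
move=> x; unlock scaleq; apply/quotient_eqP; rewrite -scalerBr rpredZ//.
by apply/quotient_eqP; rewrite reprK.
Qed.

Let scaleqA a b v : scaleq a (scaleq b v) = scaleq (a * b) v.
Proof. by rewrite -[v]reprK -!pi_scaleq scalerA. Qed.
Let scale1q : left_id 1 scaleq.
Proof. by move=> v; rewrite -[v]reprK -!pi_scaleq scale1r. Qed.
Let scaleqDr : right_distributive scaleq +%R.
Proof.
by move=> a u v; rewrite -[u]reprK -[v]reprK -!(pi_addq, pi_scaleq) scalerDr.
Qed.
Let scaleqDl v : {morph scaleq^~ v : a b / a + b}.
Proof. by move=> a b; rewrite -[v]reprK -!(pi_addq, pi_scaleq) scalerDl. Qed.

HB.instance Definition _ := GRing.Zmodule_isLmodule.Build R quotient_space
  scaleqA scale1q scaleqDr scaleqDl.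

Lemma pi_scale a : {morph \pi_Q : x / a *: x}.
Proof. exact: pi_scaleq. Qed.

Lemma pi_zero : \pi_Q 0 = 0.
Proof. by rewrite -(scale0r 0) pi_scale scale0r. Qed.

End QuotientSpace.

Section SubQuotient.
Variables (R : pzRingType) (V : lmodType R).

Section Subspace.
Variable Z : submodClosed V.

Definition subspace := {v : V | v \in Z}.

HB.instance Definition _ := SubChoice.on subspace.

Lemma subspace_closed : subsemimod_closed (fun v : V => v \in Z).
Proof.
by split; [split; [exact: rpred0|exact: rpredD]|move=> a v; exact: rpredZ].
Qed.

HB.instance Definition _ := GRing.SubChoice_isSubLmodule.Build R V _ subspace
  subspace_closed.

End Subspace.

Variables Z B : submodClosed V.

Definition trace_pred : {pred subspace Z} := [pred v | val v \in B].

Lemma trace_closed : subsemimod_closed trace_pred.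
Proof.
split; [split|].
- by rewrite inE raddf0 rpred0.
- by move=> u v; rewrite !inE raddfD; exact: rpredD.
- by move=> a v; rewrite !inE linearZ; exact: rpredZ.
Qed.

HB.instance Definition _ := GRing.isSubmodClosed.Build R (subspace Z)
  trace_pred trace_closed.

(* Z / (Z :&: B), which is Z / B when B is contained in Z *)
Definition subquotient := quotient_space trace_pred.

HB.instance Definition _ := GRing.Lmodule.on subquotient.
HB.instance Definition _ :
  EqQuotient (subspace Z) (Quotient.equiv (submod_zmod_pred trace_pred))
    subquotient :=
  EqQuotient.on subquotient.

Lemma subquotient_eqP (x y : subspace Z) :
  reflect (\pi_subquotient x = \pi_subquotient y) (val x - val y \in B).
Proof. by have := quotient_eqP trace_pred x y; rewrite inE raddfB. Qed.

End SubQuotient.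

Arguments trace_pred {R V} Z B.

Definition finite_dimensional (R : nzRingType) (V : lmodType R) : Prop :=
  exists n : nat, inhabited (Vector.axiom n V).

Section Cohomology.
Variables (R : realType) (H : groupType).

Definition cochain (n : nat) := ('I_n -> H) -> R^o.

HB.instance Definition _ n := GRing.Lmodule.on (cochain n).

(* (g_0, ..., g_n) |-> (g_1, ..., g_n) *)
Definition face_first n (g : 'I_n.+1 -> H) : 'I_n -> H :=
  fun i => g (lift ord0 i).

(* (g_0, ..., g_n) |-> (g_0, ..., g_{n-1}) *)
Definition face_last n (g : 'I_n.+1 -> H) : 'I_n -> H :=
  fun i => g (lift ord_max i).

(* (g_0, ..., g_n) |-> (g_0, ..., g_j g_{j+1}, ..., g_n) *)
Definition face_mul n (j : 'I_n) (g : 'I_n.+1 -> H) : 'I_n -> H :=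
  fun i => if (i < j)%N then g (lift ord_max i)
           else if i == j then (g (lift ord_max i) * g (lift ord0 i))%g
           else g (lift ord0 i).

Definition coboundary n (f : cochain n) : cochain n.+1 := fun g =>
  f (face_first g) + \sum_(j < n) (-1) ^+ j.+1 * f (face_mul j g)
  + (-1) ^+ n.+1 * f (face_last g).

Lemma coboundary_is_linear n : linear (@coboundary n).
Proof.
move=> a f h; apply/funext => g; rewrite /coboundary.
rewrite !fctE /= /GRing.scale/=.
under eq_bigr do rewrite mulrDr mulrCA.
rewrite big_split/= -mulr_sumr; ring.
Qed.

HB.instance Definition _ n := GRing.isLinear.Build R (cochain n) (cochain n.+1)
  _ (@coboundary n) (@coboundary_is_linear n).

Definition cocycles n : {pred cochain n} := [pred f | coboundary f == 0].
Arguments cocycles : clear implicits.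

Lemma cocycles_closed n : subsemimod_closed (cocycles n).
Proof.
split; [split|].
- by rewrite inE raddf0.
- by move=> f h; rewrite !inE raddfD /= => -> ->; rewrite addr0.
- by move=> a f; rewrite !inE linearZ/= => ->; rewrite scaler0.
Qed.

HB.instance Definition _ n :=
  GRing.isSubmodClosed.Build R (cochain n) (cocycles n) (cocycles_closed n).

(* B^0 = 0 and B^{n+1} is the image of C^n *)
Definition coboundaries n : {pred cochain n} :=
  match n with
  | 0 => [pred f | f == 0]
  | m.+1 => [pred f | `[< exists h : cochain m, f = coboundary h >]]
  end.
Arguments coboundaries : clear implicits.

Lemma coboundaries_closed n : subsemimod_closed (coboundaries n).
Proof.
case: n => [|n]; (split; [split|]) => [|f h|a f]; rewrite ?inE//.
- by move=> -> ->; rewrite addr0.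
- by move=> ->; rewrite scaler0.
- by exists 0; rewrite raddf0.
- move=> [u ->] [v ->]; exists (u + v).
  by rewrite raddfD.
- by move=> [u ->]; exists (a *: u); rewrite linearZ.
Qed.

HB.instance Definition _ n := GRing.isSubmodClosed.Build R (cochain n)
  (coboundaries n) (coboundaries_closed n).

Definition bounded_cocycles n : {pred cochain n} :=
  [pred f | (f \in cocycles n) && `[< bounded_fun f >]].
Arguments bounded_cocycles : clear implicits.

Definition bounded_coboundaries n : {pred cochain n} :=
  match n with
  | 0 => [pred f | f == 0]
  | m.+1 => [pred f |
      `[< exists2 h : cochain m, bounded_fun h & f = coboundary h >]]
  end.
Arguments bounded_coboundaries : clear implicits.

Lemma bounded_funP n (f : cochain n) :
  bounded_fun f <-> exists M : R, forall g, `|f g| <= M.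
Proof.
have PF : ProperFilter (globally [set: 'I_n -> H]).
  exact: (@globally_properfilter _ _ (fun=> 1%g)).
split=> [/ex_bound[M fM]|[M fM]]; first by exists M => g; exact: fM.
by apply/ex_bound; exists M => g _; exact: fM.
Qed.

Lemma bounded_cochain0 n : bounded_fun (0 : cochain n).
Proof. by apply/bounded_funP; exists 0 => g; rewrite normr0. Qed.

Lemma bounded_cochainD n (f h : cochain n) :
  bounded_fun f -> bounded_fun h -> bounded_fun (f + h).
Proof. exact: bounded_funD. Qed.

Lemma bounded_cochainZ n a (f : cochain n) :
  bounded_fun f -> bounded_fun (a *: f).
Proof.
move=> /bounded_funP[M fM]; apply/bounded_funP; exists (`|a| * M) => g.
by rewrite fctE normrM ler_wpM2l.
Qed.

Lemma bounded_cocycles_closed n : subsemimod_closed (bounded_cocycles n).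
Proof.
split; [split|].
- by apply/andP; split; [exact: rpred0|apply/asboolP/bounded_cochain0].
- move=> f h /andP[fZ /asboolP fb] /andP[hZ /asboolP hb]; apply/andP; split.
    exact: rpredD.
  by apply/asboolP/bounded_cochainD.
- move=> a f /andP[fZ /asboolP fb]; apply/andP; split; first exact: rpredZ.
  by apply/asboolP/bounded_cochainZ.
Qed.

HB.instance Definition _ n := GRing.isSubmodClosed.Build R (cochain n)
  (bounded_cocycles n) (bounded_cocycles_closed n).

Lemma bounded_coboundaries_closed n :
  subsemimod_closed (bounded_coboundaries n).
Proof.
case: n => [|n]; (split; [split|]) => [|f h|a f]; rewrite ?inE//.
- by move=> -> ->; rewrite addr0.
- by move=> ->; rewrite scaler0.
- exists 0; first exact: bounded_cochain0.
  by rewrite raddf0.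
- move=> [u ub ->] [v vb ->]; exists (u + v).
    exact: bounded_cochainD.
  by rewrite raddfD.
- move=> [u ub ->]; exists (a *: u).
    exact: bounded_cochainZ.
  by rewrite linearZ.
Qed.

HB.instance Definition _ n := GRing.isSubmodClosed.Build R (cochain n)
  (bounded_coboundaries n) (bounded_coboundaries_closed n).

Definition cohomology n := subquotient (cocycles n) (coboundaries n).
HB.instance Definition _ n := GRing.Lmodule.on (cohomology n).

Definition bounded_cohomology n :=
  subquotient (bounded_cocycles n) (bounded_coboundaries n).
HB.instance Definition _ n := GRing.Lmodule.on (bounded_cohomology n).

End Cohomology.

Section Quasimorphisms.
Variables (R : realType) (H : groupType).
Implicit Types (f : H -> R^o) (h x y : H).

Definition defect f : \bar R :=
  ereal_sup (range (fun p : H * H =>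
    `|f (p.1 * p.2)%g - f p.1 - f p.2|%:E)).

Definition quasimorphism f : Prop := (defect f < +oo)%E.

Definition cyclic_subgroup h : set H :=
  [set x | exists n : nat, x = (h ^+ n)%g \/ x = (h ^- n)%g].

Definition homogeneous f : Prop := forall h x y,
  cyclic_subgroup h x -> cyclic_subgroup h y -> f (x * y)%g = f x + f y.

Definition hom_pred : {pred H -> R^o} :=
  [pred f | `[< forall x y, f (x * y)%g = f x + f y >]].

Definition hqm_pred : {pred H -> R^o} :=
  [pred f | `[< quasimorphism f /\ homogeneous f >]].

Lemma defect_ge f x y : (`|f (x * y)%g - f x - f y|%:E <= defect f)%E.
Proof. by apply: ereal_sup_ubound; exists (x, y). Qed.

Lemma defect_leP f (M : \bar R) :
  (forall x y, (`|f (x * y)%g - f x - f y|%:E <= M)%E) <-> (defect f <= M)%E.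
Proof.
split=> [fM|fM x y]; last exact: le_trans (defect_ge f x y) fM.
by apply: ge_ereal_sup => _ [[x y] _ <-]; exact: fM.
Qed.

Lemma defect_ge0 f : (0 <= defect f)%E.
Proof. by apply: le_trans (defect_ge f 1%g 1%g); rewrite lee_fin. Qed.

Lemma defect_fineK f : quasimorphism f -> (fine (defect f))%:E = defect f.
Proof. by move=> fq; rewrite fineK// ge0_fin_numE// defect_ge0. Qed.

Lemma quasimorphism_bound f x y : quasimorphism f ->
  `|f (x * y)%g - f x - f y| <= fine (defect f).
Proof. by move=> fq; rewrite -lee_fin defect_fineK// defect_ge. Qed.

Lemma bound_quasimorphism f (M : R) :
  (forall x y, `|f (x * y)%g - f x - f y| <= M) ->
  quasimorphism f /\ fine (defect f) <= M.
Proof.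
move=> fM; have fM' : (defect f <= M%:E)%E by apply/defect_leP=> x y; rewrite lee_fin.
have fq : quasimorphism f by apply: le_lt_trans fM' _; rewrite ltry.
by split=> //; rewrite -lee_fin defect_fineK.
Qed.

Lemma defectD_bound f f' x y : quasimorphism f -> quasimorphism f' ->
  `|(f + f') (x * y)%g - (f + f') x - (f + f') y| <=
    fine (defect f) + fine (defect f').
Proof.
move=> fq fq'; rewrite !fctE.
have -> : f (x * y)%g + f' (x * y)%g - (f x + f' x) - (f y + f' y) =
  (f (x * y)%g - f x - f y) + (f' (x * y)%g - f' x - f' y) by ring.
by rewrite (le_trans (ler_normD _ _))// lerD// quasimorphism_bound.
Qed.

Lemma defectZ_bound a f x y : quasimorphism f ->
  `|(a *: f) (x * y)%g - (a *: f) x - (a *: f) y| <= `|a| * fine (defect f).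
Proof.
move=> fq; rewrite !fctE /GRing.scale/=.
have -> : a * f (x * y)%g - a * f x - a * f y =
  a * (f (x * y)%g - f x - f y) by ring.
by rewrite normrM ler_wpM2l// quasimorphism_bound.
Qed.

Lemma hom_pred_closed : subsemimod_closed hom_pred.
Proof.
split; [split|].
- by apply/asboolP => x y; rewrite addr0.
- move=> f f' /asboolP fh /asboolP fh'; apply/asboolP => x y.
  by rewrite !fctE fh fh' addrACA.
- move=> a f /asboolP fh; apply/asboolP => x y.
  by rewrite !fctE fh scalerDr.
Qed.

HB.instance Definition _ := GRing.isSubmodClosed.Build R (H -> R^o)
  hom_pred hom_pred_closed.

Lemma hqm_pred_closed : subsemimod_closed hqm_pred.
Proof.
split; [split|].
- apply/asboolP; split=> [|h x y _ _]; last by rewrite addr0.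
  by apply: (proj1 (@bound_quasimorphism _ 0 _)) => x y; rewrite !subr0 normr0.
- move=> f f' /asboolP[fq fh] /asboolP[fq' fh']; apply/asboolP; split.
    apply: (proj1 (@bound_quasimorphism _ _ _)) => x y.
    exact: defectD_bound.
  move=> h x y hx hy; rewrite !fctE (fh h)// (fh' h)//.
  by rewrite addrACA.
- move=> a f /asboolP[fq fh]; apply/asboolP; split.
    apply: (proj1 (@bound_quasimorphism _ _ _)) => x y.
    exact: defectZ_bound.
  by move=> h x y hx hy; rewrite !fctE (fh h)// scalerDr.
Qed.

HB.instance Definition _ := GRing.isSubmodClosed.Build R (H -> R^o)
  hqm_pred hqm_pred_closed.

Lemma homogeneousX f x n : homogeneous f -> f (x ^+ n)%g = n%:R * f x.
Proof.
move=> fh; have cyc k : cyclic_subgroup x (x ^+ k)%g by exists k; left.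
elim: n => [|n IHn].
  have := fh x 1%g 1%g (cyc 0) (cyc 0); rewrite mulg1 expg0 mul0r; lra.
by rewrite expgS (fh x) ?IHn; [rewrite -natr1; ring|exact: (cyc 1)|exact: cyc].
Qed.

Lemma hqm_conj f x h : quasimorphism f -> homogeneous f -> f (x ^ h)%g = f x.
Proof.
move=> fq fh; apply/eqP; rewrite -subr_eq0 -normr_le0; apply/negP => /negP.
rewrite -ltNge => e0.
set D := fine (defect f); set C := D + D + `|f h + f h^-1%g|.
have bnd n : n%:R * `|f (x ^ h)%g - f x| <= C.
  have -> : n%:R * `|f (x ^ h)%g - f x| = `|f ((x ^+ n) ^ h)%g - f (x ^+ n)%g|.
    by rewrite conjXg !homogeneousX// -mulrBr normrM ger0_norm.
  rewrite conjgE; set z := (x ^+ n)%g.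
  have -> : f (h^-1 * (z * h))%g - f z =
      (f (h^-1 * (z * h))%g - f h^-1%g - f (z * h)%g)
      + (f (z * h)%g - f z - f h) + (f h + f h^-1%g) by ring.
  rewrite (le_trans (ler_normD _ _))// lerD2r (le_trans (ler_normD _ _))//.
  by rewrite lerD// quasimorphism_bound.
have [n] : exists n : nat, C / `|f (x ^ h)%g - f x| < n%:R.
  eexists; apply: archi_boundP; apply: divr_ge0 => //.
  by have := bnd 0; rewrite mul0r.
by rewrite ltr_pdivrMr// ltNge bnd.
Qed.

End Quasimorphisms.

(* Q(H) / H^1(H) *)
Definition hqm_mod_hom (R : realType) (H : groupType) :=
  subquotient (@hqm_pred R H) (@hom_pred R H).
HB.instance Definition _ R H := GRing.Lmodule.on (hqm_mod_hom R H).
HB.instance Definition _ R H :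
  EqQuotient _ (Quotient.equiv (submod_zmod_pred
      (trace_pred (@hqm_pred R H) (@hom_pred R H))))
    (hqm_mod_hom R H) := EqQuotient.on (hqm_mod_hom R H).

Section InvariantQuasimorphisms.
Variables (R : realType) (G : groupType) (N : normalSubgroup G).
Implicit Type f : subgroup N -> R^o.

Definition conj_invariant f : Prop :=
  forall (x : subgroup N) (g : G), f (subgroup_conj x g) = f x.

(* Q(N)^G *)
Definition inv_hqm_pred : {pred subgroup N -> R^o} :=
  [pred f | (f \in @hqm_pred R (subgroup N)) && `[< conj_invariant f >]].

(* H^1(N)^G *)
Definition inv_hom_pred : {pred subgroup N -> R^o} :=
  [pred f | (f \in @hom_pred R (subgroup N)) && `[< conj_invariant f >]].

Lemma conj_invariant0 : conj_invariant 0.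
Proof. by []. Qed.

Lemma conj_invariantD f f' :
  conj_invariant f -> conj_invariant f' -> conj_invariant (f + f').
Proof. by move=> fi fi' x g; rewrite !fctE fi fi'. Qed.

Lemma conj_invariantZ a f : conj_invariant f -> conj_invariant (a *: f).
Proof. by move=> fi x g; rewrite !fctE fi. Qed.

Lemma inv_hqm_pred_closed : subsemimod_closed inv_hqm_pred.
Proof.
split; [split|].
- by apply/andP; split; [exact: rpred0|apply/asboolP/conj_invariant0].
- move=> f f' /andP[fQ /asboolP fi] /andP[fQ' /asboolP fi']; apply/andP; split.
    exact: rpredD.
  by apply/asboolP/conj_invariantD.
- move=> a f /andP[fQ /asboolP fi]; apply/andP; split; first exact: rpredZ.
  by apply/asboolP/conj_invariantZ.
Qed.

HB.instance Definition _ := GRing.isSubmodClosed.Build R (subgroup N -> R^o)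
  inv_hqm_pred inv_hqm_pred_closed.

Lemma inv_hom_pred_closed : subsemimod_closed inv_hom_pred.
Proof.
split; [split|].
- by apply/andP; split; [exact: rpred0|apply/asboolP/conj_invariant0].
- move=> f f' /andP[fQ /asboolP fi] /andP[fQ' /asboolP fi']; apply/andP; split.
    exact: rpredD.
  by apply/asboolP/conj_invariantD.
- move=> a f /andP[fQ /asboolP fi]; apply/andP; split; first exact: rpredZ.
  by apply/asboolP/conj_invariantZ.
Qed.

HB.instance Definition _ := GRing.isSubmodClosed.Build R (subgroup N -> R^o)
  inv_hom_pred inv_hom_pred_closed.

(* Q(N)^G / H^1(N)^G *)
Definition inv_hqm_mod_hom := subquotient inv_hqm_pred inv_hom_pred.

HB.instance Definition _ := GRing.Lmodule.on inv_hqm_mod_hom.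
HB.instance Definition _ :
  EqQuotient _ (Quotient.equiv (submod_zmod_pred
      (trace_pred inv_hqm_pred inv_hom_pred)))
    inv_hqm_mod_hom := EqQuotient.on inv_hqm_mod_hom.

Local Notation Q := inv_hqm_mod_hom.

Lemma inv_hqmP (u : subspace inv_hqm_pred) :
  [/\ quasimorphism (val u), homogeneous (val u) & conj_invariant (val u)].
Proof. by have /andP[/asboolP[uq uh] /asboolP ui] := valP u. Qed.

(* independent of the representative by defect_norm_pi below *)
Definition defect_norm (c : Q) : R := fine (defect (val (repr c))).

Lemma defect_hom f f' : f - f' \in @hom_pred R (subgroup N) ->
  defect f = defect f'.
Proof.
move=> /asboolP fh; rewrite /defect; congr ereal_sup.
apply: eq_imagel => -[x y] _ /=; congr (`|_|%:E).
by have := fh x y; rewrite !fctE; lra.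
Qed.

Lemma defect_norm_pi (u : subspace inv_hqm_pred) :
  defect_norm (\pi_Q u) = fine (defect (val u)).
Proof.
rewrite /defect_norm; congr fine; apply: defect_hom.
have : val (repr (\pi_Q u)) - val u \in inv_hom_pred.
  by apply/subquotient_eqP; rewrite reprK.
by case/andP.
Qed.

Let ler_defect_normD (c c' : Q) :
  defect_norm (c + c') <= defect_norm c + defect_norm c'.
Proof.
rewrite -[c]reprK -[c']reprK -pi_addq !defect_norm_pi raddfD.
have [uq _ _] := inv_hqmP (repr c); have [uq' _ _] := inv_hqmP (repr c').
by have [] := bound_quasimorphism (fun x y => defectD_bound x y uq uq').
Qed.

Let defect_norm_leZ (a : R) (c : Q) :
  defect_norm (a *: c) <= `|a| * defect_norm c.
Proof.
have [uq _ _] := inv_hqmP (repr c).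
rewrite -[c]reprK -pi_scale !defect_norm_pi linearZ.
by have [] := bound_quasimorphism (fun x y => defectZ_bound a x y uq).
Qed.

Let defect_normZ (a : R) (c : Q) :
  defect_norm (a *: c) = `|a| * defect_norm c.
Proof.
apply/eqP; rewrite eq_le defect_norm_leZ/=.
have [->|a0] := eqVneq a 0; first by rewrite normr0 mul0r fine_ge0// defect_ge0.
have := defect_norm_leZ a^-1 (a *: c).
by rewrite scalerA mulVf// scale1r normfV ler_pdivlMl// normr_gt0.
Qed.

Let defect_norm_eq0 (c : Q) : defect_norm c = 0 -> c = 0.
Proof.
have [uq _ ui] := inv_hqmP (repr c).
rewrite -[c]reprK defect_norm_pi => u0.
rewrite -[RHS](pi_zero (trace_pred inv_hqm_pred inv_hom_pred)).
apply/subquotient_eqP; rewrite -raddfB subr0.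
apply/andP; split; apply/asboolP => // x y.
have := quasimorphism_bound x y uq.
by rewrite u0 normr_le0 -addrA -opprD subr_eq0 => /eqP.
Qed.

HB.instance Definition _ := Lmodule_isNormed.Build R inv_hqm_mod_hom
  ler_defect_normD defect_normZ defect_norm_eq0.

Lemma norm_inv_hqm_pi (u : subspace inv_hqm_pred) :
  `|\pi_Q u| = fine (defect (val u)).
Proof. exact: defect_norm_pi. Qed.

Lemma hqm_restrict_subproof (u : subspace (@hqm_pred R G)) :
  (fun x : subgroup N => val u (val x)) \in inv_hqm_pred.
Proof.
have /asboolP[uq uh] := valP u; apply/andP; split; apply/asboolP; last first.
  by move=> x g; rewrite SubK hqm_conj.
split=> [|h x y hx hy].
  apply: (proj1 (@bound_quasimorphism _ _ _ (fine (defect (val u))) _)) => x y.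
  by rewrite valM quasimorphism_bound.
rewrite valM; apply: (uh (val h)).
  by case: hx => n [->|->]; exists n; [left|right]; rewrite ?gmulfV gmulfXn.
by case: hy => n [->|->]; exists n; [left|right]; rewrite ?gmulfV gmulfXn.
Qed.

Definition hqm_restrict (u : subspace (@hqm_pred R G)) : subspace inv_hqm_pred :=
  Sub (fun x : subgroup N => val u (val x)) (hqm_restrict_subproof u).

(* [phi] |-> [phi|_N]; independent of the representative by ihat_pi below *)
Definition ihat (c : hqm_mod_hom R G) : inv_hqm_mod_hom :=
  \pi_Q (hqm_restrict (repr c)).

Lemma ihat_pi (u : subspace (@hqm_pred R G)) :
  ihat (\pi_(hqm_mod_hom R G) u) = \pi_Q (hqm_restrict u).
Proof.
have : val (repr (\pi_(hqm_mod_hom R G) u)) - val u \in @hom_pred R G.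
  by apply/subquotient_eqP; rewrite reprK.
move=> /asboolP uh; apply/subquotient_eqP; apply/andP; split; apply/asboolP.
  by move=> x y; rewrite /= !fctE; have := uh (val x) (val y); rewrite !fctE.
by move=> x g; have [_ _ i1] := inv_hqmP (hqm_restrict (repr (\pi_(hqm_mod_hom R G) u)));
  have [_ _ i2] := inv_hqmP (hqm_restrict u); rewrite !fctE i1 i2.
Qed.

End InvariantQuasimorphisms.

(* Main.v *)
Require Import Defs.
From HB Require Import structures.
From mathcomp Require Import all_boot all_order all_algebra.
From mathcomp Require Import all_classical all_reals all_analysis.
From mathcomp Require Import ring lra.

Set Implicit Arguments.
Unset Strict Implicit.
Unset Printing Implicit Defensive.

Import Order.TTheory GRing.Theory Num.Theory.
Import numFieldNormedType.Exports.

Local Open Scope classical_set_scope.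
Local Open Scope quotient_scope.
Local Open Scope ring_scope.

(** Write Gamma = G / N. Extending f in Q(N)^G along a transversal of N gives a
    function on G whose coboundary is, up to an error bounded by D(f), inflated
    from a 2-cochain alpha_f on Gamma; so delta alpha_f is a 3-cocycle of norm
    at most 16 D(f). If f is the limit of restrictions f_j then
    alpha_(f_j) = b_j - delta u_j with b_j bounded. Since H^3_b(Gamma) is
    finite-dimensional, a Baire argument yields primitives of bounded
    3-coboundaries with linear control of the norm; hence
    delta alpha_f = delta b_0 with b_0 bounded, and b_j - b_0 is a bounded
    cocycle up to a cochain tending to 0. Either assumption in (b) makes the
    image of H^2_b(Gamma) in H^2(Gamma) finite-dimensional, spanned by
    c_1, ..., c_m say. Thus the inflation of alpha_f - b_0 to G equals
    sum_i t_ij c_i + delta v_j + o(1). There is no control on t_ij and v_j, but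
    applying pointwise a linear functional on all real sequences that extends
    the limit gives alpha_f - b_0 = sum_i t_i c_i + delta v on G exactly.
    Then v restricts on N, up to a constant, to a G-invariant homomorphism k,
    and the homogenization of (extension of f) - v restricts to f - k. *)

(** * Generalized limits *)

(** Zorn's lemma gives a maximal [W] meeting [S] only in 0. If some [x] lay outside [S + W], the
    span of [W] and [x] would be strictly larger. *)
Lemma linear_complement (K : fieldType) (V : lmodType K) (S : set V) :
    S 0 -> (forall a u v, S u -> S v -> S (a *: u + v)) ->
  exists W : set V, [/\ W 0, forall a u v, W u -> W v -> W (a *: u + v),
    forall v, S v -> W v -> v = 0
    & forall x, exists v w, [/\ S v, W w & x = v + w]].
Proof.
move=> S0 SL.
pose P := [set A : set V | (forall a u v, A u -> A v -> A (a *: u + v)) /\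
  (forall v, S v -> A v -> v = 0)].
have [F FP Ftot|W [[WL WS] Wmax]] := @Zorn_bigcup _ P.
  split=> [a u v [A FA Au] [B FB Bv]|v Sv [A FA Av]]; last first.
    by have [_ /(_ v Sv Av)] := FP _ FA.
  have [AB|BA] := Ftot _ _ FA FB.
    by exists B => //; apply: (proj1 (FP _ FB)) => //; exact: AB.
  by exists A => //; apply: (proj1 (FP _ FA)) => //; exact: BA.
(* The empty set satisfies [P] vacuously, so 0 has to be obtained from maximality. *)
have W0 : W 0.
  apply: contrapT => W0; apply: (Wmax [set 0]).
    split=> [v Wv|/(_ 0 erefl)]//; exfalso; apply: W0.
    by rewrite -(addNr v) -scaleN1r; exact: WL.
  by split=> [a u v -> ->|v _ ->//]; rewrite /= scaler0 addr0.
exists W; split=> // x; apply: contrapT => xSW.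
pose W' := [set y | exists a w, W w /\ y = a *: x + w].
apply: (Wmax W').
  split=> [w Ww|/(_ x) W'W]; first by exists 0, w; rewrite scale0r add0r.
  apply: xSW; exists 0, x; rewrite add0r; split=> //; apply: W'W.
  by exists 1, 0; rewrite scale1r addr0.
split=> [a _ _ [b [w [Ww ->]]] [c [w' [Ww' ->]]]|v Sv [a [w [Ww vE]]]].
  exists (a * b + c), (a *: w + w'); split; first exact: WL.
  by rewrite scalerDr scalerDl scalerA addrACA.
have [a0|a0] := eqVneq a 0.
  by apply: WS => //; rewrite vE a0 scale0r add0r.
exfalso; apply: xSW; exists (a^-1 *: v), (- a^-1 *: w); split.
- by rewrite -[_ *: v]addr0; exact: SL.
- by rewrite -[_ *: w]addr0; exact: WL.
- by rewrite vE scalerDr scalerA mulVf// scale1r scaleNr addrK.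
Qed.

(** A Banach limit without shift invariance, but defined on unbounded sequences too: these arise
    later as uncontrolled coefficients and primitives. *)
Definition generalized_limit (R : realType) (L : (nat -> R) -> R) : Prop :=
  [/\ forall a u v, L (fun n => a * u n + v n) = a * L u + L v,
      forall u l, u @ \oo --> l -> L u = l
    & forall u M, (forall n, `|u n| <= M) -> `|L u| <= M].

Lemma ultrafilter_fmap (S T : Type) (f : S -> T) (U : set_system S) :
  UltraFilter U -> UltraFilter (f @ U).
Proof.
move=> UU; have [PU _] := UU; split; first exact: fmap_proper_filter.
move=> G PG UG; apply/seteqP; split=> [A GA|]; last exact: UG.
have [//|/= UA] := in_ultra_setVsetC (f @^-1` A) UU.
have /filter_ex[x []//] : G (A `&` ~` A) by apply: filterI => //; exact: UG.
Qed.

Lemma ultrafilter_bounded_cvg (R : realType) (U : set_system nat)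
    (u : nat -> R) (M : R) :
  UltraFilter U -> (forall n, `|u n| <= M) ->
  exists2 l, u @ U --> l & `|l| <= M.
Proof.
move=> UU uM.
have uU : (u @ U) `[- M, M]%classic.
  have [PU _] := UU; apply: (@filterS _ U _ setT) filterT => n _ /=.
  by have := uM n; rewrite in_itv/= ler_norml.
have := @segment_compact R (- M) M.
rewrite compact_ultra.
move=> /(_ (u @ U) (@ultrafilter_fmap _ _ u U UU) uU)[l [lM ul]].
exists l => //; by move: lM; rewrite /= in_itv/= -ler_norml.
Qed.

(* The limit along a free ultrafilter, extended linearly to the unbounded
   sequences by means of an algebraic complement. *)
Lemma generalized_limit_exists (R : realType) :
  exists L : (nat -> R) -> R, generalized_limit L.
Proof.
(* [U] refines the eventual filter, so limits along [U] extend ordinary limits. *)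
have [U [UU oU]] := ultraFilterLemma eventually_filter.
have [PU _] := UU.
pose S : set (nat -> R^o) := [set u | cvg (u @ U)].
have SL a u v : S u -> S v -> S (a *: u + v).
  by move=> Su Sv; apply: is_cvgD => //; exact: is_cvgZr.
have [|//|W [W0 WL SW0 SW]] := @linear_complement _ (nat -> R^o) S.
  exact: is_cvg_cst.
have [p pP] := choice SW.
have {pP} pP u : exists w, [/\ S (p u), W w & u = p u + w] by [].
(* Uniqueness of the decomposition makes the arbitrarily chosen component [p] linear. *)
have {SW} p_eq u v w : S v -> W w -> u = v + w -> p u = v.
  move=> Sv Ww uE; have [w' [Sp Ww' uE']] := pP u.
  apply/eqP; rewrite -subr_eq0; apply/eqP; apply: SW0.
    by rewrite addrC -scaleN1r; exact: SL.
  have -> : p u - v = - 1 *: w' + w.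
    have -> : p u = v + w - w' by rewrite -uE [in RHS]uE' addrK.
    by rewrite scaleN1r -[v + w - w']addrA [v + _]addrC addrK addrC.
  exact: WL.
pose L (u : nat -> R^o) : R := lim (p u @ U).
exists L; split.
- move=> a u v; have [w [Su Ww uE]] := pP u; have [w' [Sv Ww' vE]] := pP v.
  have E : p (a *: (u : nat -> R^o) + v) = a *: p u + p v.
    apply: (p_eq _ _ (a *: w + w')); [exact: SL|exact: WL|].
    by rewrite {1}uE {1}vE scalerDr addrACA.
  rewrite /L; rewrite -[X in p X]/(a *: (u : nat -> R^o) + v) E.
  apply/cvg_lim => //; apply: cvgD => //; exact: cvgZr.
- move=> u l ul; have uU : u @ U --> l.
    by apply: cvg_trans ul; apply: cvg_app.
  rewrite /L (p_eq u u 0) ?addr0//; last by apply/cvg_ex; exists l.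
  exact/cvg_lim.
- move=> u M uM; have [l ul lM] := ultrafilter_bounded_cvg UU uM.
  rewrite /L (p_eq u u 0) ?addr0//; last by apply/cvg_ex; exists l.
  by have -> : lim (u @ U) = l by exact/cvg_lim.
Qed.
(** * Baire category for the sup norm *)

(** Phrased on all functions, without a norm, since sup distances may be infinite. *)
Definition uniformly_closed (R : realType) (S : Type) (A : set (S -> R)) :=
  forall s, (forall e, 0 < e -> exists2 u, A u & forall x, `|u x - s x| <= e) ->
    A s.

(** The second hypothesis says that each closed ball contains the next. At every point the balls cut
    out nested intervals, and the supremum of the left endpoints lies in all of them. *)
Lemma nested_balls (R : realType) (S : Type) (s : nat -> S -> R)
    (r : nat -> R) :
    (forall k, 0 <= r k) ->
    (forall k x, `|s k.+1 x - s k x| <= r k - r k.+1) ->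
  exists t, forall k x, `|s k x - t x| <= r k.
Proof.
move=> r0 sr.
have lo x : {homo (fun k => s k x - r k) : k m / (k <= m)%N >-> k <= m}.
  apply: homo_leq => [//|? ? ?|k]; first exact: le_trans.
  by have := sr k x; rewrite ler_norml; lra.
have up x : {homo (fun k => s k x + r k) : k m / (k <= m)%N >-> m <= k}.
  apply: homo_leq => [//|? ? ? /[swap]|k]; first exact: le_trans.
  by have := sr k x; rewrite ler_norml; lra.
have lo_up x m k : s m x - r m <= s k x + r k.
  have [mk|/ltnW km] := leqP m k.
    by rewrite (le_trans (lo x _ _ mk))//; have := r0 k; lra.
  by rewrite (le_trans _ (up x _ _ km))//; have := r0 m; lra.
exists (fun x => sup (range (fun m => s m x - r m))) => k x.
have supU : ubound (range (fun m => s m x - r m)) (s k x + r k).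
  by move=> _ [m _ <-].
have : sup (range (fun m => s m x - r m)) <= s k x + r k.
  by apply: ge_sup => //; exists (s 0%N x - r 0%N); exists 0%N.
have : s k x - r k <= sup (range (fun m => s m x - r m)).
  by apply: ub_le_sup; [exists (s k x + r k)|exists k].
rewrite ler_norml; lra.
Qed.

(** If no [A k] contained a ball of [Y] about 0, then by differences none would contain a ball about
    any point. Nested balls could then avoid every [A k] in turn, and their common point would
    contradict the covering of [Y]. *)
Lemma uniform_baire (R : realType) (S : Type) (Y : set (S -> R))
    (A : nat -> set (S -> R)) :
    (forall u v, Y u -> Y v -> Y (fun x => u x + v x)) -> Y (fun=> 0) ->
    uniformly_closed Y -> (forall k, uniformly_closed (A k)) ->
    (forall y, Y y -> exists k, A k y) ->
    (forall j k u v, A j u -> A k v -> A (j + k)%N (fun x => u x - v x)) ->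
  exists k r, 0 < r /\ forall y, Y y -> (forall x, `|y x| <= r) -> A k y.
Proof.
move=> YD Y0 Yc Ac AY AB; apply: contrapT => noball.
have small k r : 0 < r -> exists y, [/\ Y y, forall x, `|y x| <= r & ~ A k y].
  move=> r0; apply: contrapT => noy; apply: noball.
  exists k, r; split=> // y Yy yr.
  by apply: contrapT => Aky; apply: noy; exists y.
have step (p : nat * ((S -> R) * R)) : exists q : (S -> R) * R,
    Y p.2.1 -> 0 < p.2.2 ->
    [/\ Y q.1, 0 < q.2, q.2 <= p.2.2 / 2,
        forall x, `|q.1 x - p.2.1 x| <= p.2.2 / 2
     & forall u, A p.1 u -> ~ forall x, `|u x - q.1 x| <= q.2].
  case: p => k [s r] /=.
  have [Ys|] := pselect (Y s); last by exists (s, r).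
  have [r0|] := pselect (0 < r); last by exists (s, r).
  have [m Ams] := AY _ Ys.
  (* The index [k + m] is chosen because [s + y] in [A k] and [s] in [A m] would put [y] in
     [A (k + m)]. *)
  have [|y [Yy yr Ay]] := @small (k + m)%N (r / 2); first by rewrite divr_gt0.
  pose t := fun x => s x + y x.
  have Akt : ~ A k t.
    move=> /AB/(_ Ams); congr (~ _): Ay; congr A.
    by apply/funext => x; rewrite /t addrC addKr.
  have [e [e0 he]] : exists e, 0 < e /\ forall u, A k u ->
      ~ forall x, `|u x - t x| <= e.
    apply: contrapT => noe; apply: Akt; apply: Ac => e e0.
    apply: contrapT => nou; apply: noe; exists e; split=> // u Aku ut.
    by apply: nou; exists u.
  exists (t, Num.min e (r / 2)) => _ _ /=; split=> //.
  - exact: YD.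
  - by rewrite lt_min e0 divr_gt0.
  - by rewrite ge_min lexx orbT.
  - by move=> x; rewrite /t addrC addKr.
  - move=> u /he ue ut; apply: ue => x; rewrite (le_trans (ut x))//.
    by rewrite ge_min lexx.
have {step} [f fP] := choice step.
pose p := fix p k : (S -> R) * R :=
  if k is k'.+1 then f (k', p k') else (fun=> 0, 1).
have pP k : Y (p k).1 /\ 0 < (p k).2.
  elim: k => [//|k [Yk pk]] /=.
  by have [] := fP (k, p k) Yk pk.
have pS k := let: conj Yk rk := pP k in fP (k, p k) Yk rk.
have [||t tP] := @nested_balls R S (fun k => (p k).1) (fun k => (p k).2).
- by move=> k; have [_ /ltW] := pP k.
- move=> k x; have [_ _ + + _] := pS k => /= p2 /(_ x) /le_trans; apply.
  by move: p2; rewrite /=; lra.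
have pr k : (p k).2 <= 2^-1 ^+ k.
  elim: k => [|k IHk]; first by rewrite expr0.
  have [_ _ /= + _ _] := pS k => /le_trans; apply.
  by rewrite exprSr ler_wpM2r.
(* The radii at least halve at each step, so the centres converge uniformly to [t]. *)
have Yt : Y t.
  apply: Yc => e e0.
  have [k ke] : exists k, (2^-1 : R) ^+ k <= e.
    have : (2^-1 : R) ^+ k @[k --> \oo] --> 0.
      by apply: cvg_expr; rewrite ger0_norm ?invr_ge0// invf_lt1// ltr1n.
    move=> /cvgrPdist_le/(_ _ e0)[k _ /(_ k (leqnn k))] /=.
    by rewrite sub0r normrN => /(le_trans (ler_norm _)); exists k.
  exists (p k).1 => [|x]; first by have [] := pP k.
  by rewrite (le_trans (tP k x))// (le_trans (pr k)).
have [k Akt] := AY _ Yt.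
have [_ _ _ _ /= /(_ _ Akt)] := pS k; apply => x.
by rewrite distrC; exact: (tP k.+1).
Qed.

(** * Calculus of generalized limits *)

Section GeneralizedLimit.
Variables (R : realType) (L : (nat -> R) -> R).
Hypothesis Llim : generalized_limit L.

Lemma glimP u l : u @ \oo --> l -> L u = l.
Proof. by case: Llim => _ + _; apply. Qed.

Lemma glim_le u M : (forall n, `|u n| <= M) -> `|L u| <= M.
Proof. by case: Llim => _ _; apply. Qed.

Lemma glim_cst a : L (fun=> a) = a.
Proof. by apply: glimP; exact: cvg_cst. Qed.

Lemma glim_lin a u v : L (fun n => a * u n + v n) = a * L u + L v.
Proof. by case: Llim. Qed.

Lemma glimD u v : L (fun n => u n + v n) = L u + L v.
Proof.
rewrite -[L u]mul1r -glim_lin; congr L.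
by apply/funext => n; rewrite mul1r.
Qed.

Lemma glimZ a u : L (fun n => a * u n) = a * L u.
Proof.
rewrite -[RHS]addr0 -[X in _ + X](glim_cst 0) -glim_lin; congr L.
by apply/funext => n; rewrite addr0.
Qed.

Lemma glimB u v : L (fun n => u n - v n) = L u - L v.
Proof.
rewrite -mulN1r -glimZ -glimD; congr L.
by apply/funext => n; rewrite mulN1r.
Qed.

Lemma glim_sum (I : Type) (r : seq I) (F : I -> nat -> R) :
  L (fun n => \sum_(i <- r) F i n) = \sum_(i <- r) L (F i).
Proof.
elim: r => [|i r IHr].
  rewrite big_nil -[RHS](glim_cst 0); congr L.
  by apply/funext => n; rewrite big_nil.
rewrite big_cons -IHr -glimD; congr L.
by apply/funext => n; rewrite big_cons.
Qed.

Lemma glim_eq u v : u n - v n @[n --> \oo] --> 0 -> L u = L v.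
Proof. by move=> /glimP; rewrite glimB => /eqP; rewrite subr_eq0 => /eqP. Qed.

End GeneralizedLimit.

Section CochainLimits.
Variables (R : realType) (H : groupType) (L : (nat -> R) -> R).
Hypothesis Llim : generalized_limit L.

(** A value of the coboundary is a finite linear combination of values of the cochain. *)
Lemma glim_coboundary n (f : nat -> cochain R H n) g :
  coboundary (fun h => L (fun j => f j h) : R^o) g =
  L (fun j => coboundary (f j) g).
Proof.
rewrite /coboundary !(glimD Llim) (glimZ Llim) (glim_sum Llim).
by congr (_ + _ + _); apply: eq_bigr => i _; rewrite (glimZ Llim).
Qed.

End CochainLimits.

(** Pulls an isomorphism of the subquotient with row vectors back to [V]: [q] gives the coordinates
    of a class, and the [y i] represent the dual basis. *)
Lemma subquotient_coordinates (K : fieldType) (V : lmodType K)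
    (Z B : submodClosed V) :
    finite_dimensional (subquotient Z B) ->
  exists m (q : V -> 'I_m -> K) (y : 'I_m -> V),
  [/\ forall i, y i \in Z,
      forall a u v i, u \in Z -> v \in Z ->
        q (a *: u + v) i = a * q u i + q v i,
      forall u, u \in Z -> (u \in B) <-> (forall i, q u i = 0)
    & forall a i, q (\sum_j a j *: y j) i = a i].
Proof.
move=> [m [[f flin [g fK gK]]]].
have f0 : f 0 = 0.
  by have := flin (- 1) 0 0; rewrite !scaleN1r !addNr.
(* Vectors outside [Z] get the class of the default 0, so linearity is claimed on [Z]. *)
pose q (u : V) (i : 'I_m) : K :=
  f (\pi_(subquotient Z B) (insubd (0 : Defs.subspace Z) u)) 0 i.
have qE (u : Defs.subspace Z) i : q (val u) i = f (\pi_(subquotient Z B) u) 0 i.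
  by rewrite /q valKd.
pose y i := val (repr (g (delta_mx 0 i))) : V.
have yZ i : y i \in Z by exact: valP.
have qlin a u v i : u \in Z -> v \in Z -> q (a *: u + v) i = a * q u i + q v i.
  move=> uZ vZ.
  have -> : a *: u + v = val (a *: (Sub u uZ : Defs.subspace Z) + Sub v vZ).
    by rewrite linearP.
  by rewrite qE pi_addq pi_scale flin !mxE -!qE !SubK.
have q00 i : q 0 i = 0.
  by have := qlin (- 1) 0 0 i (rpred0 _) (rpred0 _);
    rewrite scaler0 addr0 mulN1r addNr.
exists m, q, y; split=> //.
- move=> u uZ.
  have E : (u \in B) <->
      (\pi_(subquotient Z B) (Sub u uZ : Defs.subspace Z) = 0).
    rewrite -(pi_zero (trace_pred Z B)).
    rewrite -[X in X \in B]subr0.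
    rewrite -[X in _ - X \in _](raddf0 (val : Defs.subspace Z -> V)).
    by rewrite -[X in X - _](SubK (Defs.subspace Z) uZ);
      split=> /subquotient_eqP.
  split=> [/E u0 i|u0].
    by rewrite -[u](SubK (Defs.subspace Z) uZ) qE u0 f0 mxE.
  apply/E; rewrite -[LHS]fK -[RHS]fK f0; congr g; apply/rowP => i.
  by rewrite -qE SubK u0 mxE.
- move=> a i.
  have -> (r : seq 'I_m) : q (\sum_(j <- r) a j *: y j) i =
      \sum_(j <- r) a j * (j == i)%:R.
    elim: r => [|j r IHr]; first by rewrite !big_nil q00.
    rewrite !big_cons qlin ?IHr ?yZ//; last first.
      by apply: rpred_sum => *; exact: rpredZ.
    by rewrite qE reprK gK mxE eqxx eq_sym.
  rewrite (bigD1 i)//= eqxx mulr1 big1 ?addr0// => j /negbTE->.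
  by rewrite mulr0.
Qed.

(** * Cochains of low degree *)

Section LowDegree.
Variables (R : realType) (H : groupType).
Implicit Types (u : H -> R) (b : H -> H -> R).

Definition delta1 u x y := u x + u y - u (x * y)%g.

Definition delta2 b x y z :=
  b y z - b (x * y)%g z + b x (y * z)%g - b x y.

Definition cochain1_of u : cochain R H 1 := fun g => u (g ord0).

Definition cochain2_of b : cochain R H 2 := fun g => b (g ord0) (g ord_max).

Definition word2 (x y : H) : 'I_2 -> H := fun i => nth x [:: x; y] i.

Definition word3 (x y z : H) : 'I_3 -> H := fun i => nth x [:: x; y; z] i.

Lemma cochain1P (f : cochain R H 1) : exists u, f = cochain1_of u.
Proof.
exists (fun x => f (fun=> x)); apply/funext => g; congr f.
by apply/funext => i; rewrite ord1.
Qed.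

Lemma cochain2P (f : cochain R H 2) : exists b, f = cochain2_of b.
Proof.
exists (fun x y => f (word2 x y)); apply/funext => g; congr f.
by apply/funext => -[[|[|//]] ?] /=; congr g; exact: val_inj.
Qed.

Lemma coboundary1E u (g : 'I_2 -> H) :
  coboundary (cochain1_of u) g = delta1 u (g ord0) (g ord_max).
Proof.
(* Indexing by natural numbers lets the face maps compute, so that [ring] recognizes equal
   arguments. *)
pose h (k : nat) := g (inord k).
have -> : g = fun i => h i by apply/funext => i; rewrite /h inord_val.
by rewrite /coboundary big_ord1 /delta1 /cochain1_of /face_first/=; ring.
Qed.

Lemma coboundary2E b (g : 'I_3 -> H) :
  coboundary (cochain2_of b) g =
  delta2 b (g ord0) (g (@Ordinal 3 1 isT)) (g ord_max).
Proof.
pose h (k : nat) := g (inord k).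
have -> : g = fun i => h i by apply/funext => i; rewrite /h inord_val.
rewrite /coboundary !big_ord_recl big_ord0 /cochain2_of /delta2.
rewrite /face_first /face_mul /face_last /bump /=.
by ring.
Qed.

Lemma coboundary2_word3 b x y z :
  coboundary (cochain2_of b) (word3 x y z) = delta2 b x y z.
Proof. by rewrite coboundary2E. Qed.

Lemma delta2_le b B x y z :
  (forall x y, `|b x y| <= B) -> `|delta2 b x y z| <= 4 * B.
Proof.
move=> bB; have := bB y z; have := bB (x * y)%g z; have := bB x (y * z)%g.
have := bB x y; rewrite /delta2 !ler_norml; lra.
Qed.

Lemma delta2_delta1 u x y z : delta2 (delta1 u) x y z = 0.
Proof. by rewrite /delta2 /delta1 mulgA; ring. Qed.

Lemma coboundary2_coboundary b g :
  coboundary (coboundary (cochain2_of b)) g = 0.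
Proof.
pose h (k : nat) := g (inord k).
have -> : g = fun i => h i by apply/funext => i; rewrite /h inord_val.
have fE := coboundary2E b; set f := coboundary (cochain2_of b) in fE *.
rewrite /coboundary !big_ord_recl big_ord0 !fE.
rewrite /delta2 /face_first /face_mul /face_last /bump /=.
rewrite !mulgA; ring.
Qed.

End LowDegree.

Lemma cvg_harmonic_bound (R : realType) (u : nat -> R) (l C : R) :
  (forall n, `|u n - l| <= C * n.+1%:R^-1) -> u @ \oo --> l.
Proof.
move=> uC.
have C0 : C * n.+1%:R^-1 @[n --> \oo] --> 0.
  by rewrite -[X in _ --> X](mulr0 C);
    apply: cvgM; [exact: cvg_cst|exact: cvg_harmonic].
apply: (@squeeze_cvgr _ _ _ _ (fun n => l - C * n.+1%:R^-1)
  (fun n => l + C * n.+1%:R^-1)).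
- apply: nearW => n /=; have := uC n; rewrite ler_norml.
  move: (C * _) => e; lra.
- by rewrite -[X in _ --> X](subr0 l); apply: cvgB => //; exact: cvg_cst.
- by rewrite -[X in _ --> X](addr0 l); apply: cvgD => //; exact: cvg_cst.
Qed.

(** Turns uniform approximation into a sequence to which a generalized limit applies pointwise. *)
Lemma uniform_closure_seq (R : realType) (S : Type) (A : set (S -> R)) s :
    (forall e, 0 < e -> exists2 u, A u & forall x, `|u x - s x| <= e) ->
  exists u : nat -> S -> R,
    (forall n, A (u n)) /\ forall x, u n x @[n --> \oo] --> s x.
Proof.
move=> sA.
have /choice[u uP] : forall n : nat, exists u : S -> R,
    A u /\ forall x, `|u x - s x| <= n.+1%:R^-1.
  by move=> n; have [|u Au us] := sA n.+1%:R^-1; [rewrite invr_gt0|exists u].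
exists u; split=> [n|x]; first by have [] := uP n.
apply: (@cvg_harmonic_bound _ _ _ 1) => n; rewrite mul1r.
by have [_] := uP n.
Qed.

Lemma bounded_cocyclesP (R : realType) (H : groupType) n (f : cochain R H n) :
  f \in @bounded_cocycles R H n <->
  (forall g, coboundary f g = 0) /\ exists M, forall g, `|f g| <= M.
Proof.
split=> [/andP[/eqP fZ /asboolP/Defs.bounded_funP fb]|[fZ fb]].
  by split=> // g; rewrite fZ.
apply/andP; split; last exact/asboolP/Defs.bounded_funP.
by apply/eqP; apply/funext => g; rewrite fZ.
Qed.

(** * Finite-dimensional cohomology *)

(** An open mapping argument: bounded 2-cochains together with the finitely many representatives
    [y i] map onto the bounded 3-cocycles, so by Baire the image of some ball contains a ball about
    0. *)
Lemma bounded_primitive (R : realType) (H : groupType) :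
    finite_dimensional (bounded_cohomology R H 3) ->
  exists2 C : R, 0 <= C & forall (f : cochain R H 2) (M : R),
    (exists B, forall g, `|f g| <= B) -> (forall g, `|coboundary f g| <= M) ->
    exists f' : cochain R H 2,
      (forall g, `|f' g| <= C * M) /\ coboundary f' = coboundary f.
Proof.
move=> /subquotient_coordinates[m [q [y [yZ qlin q0 qy]]]].
have [L Llim] := generalized_limit_exists R.
pose Z : set (cochain R H 3) := [set z | z \in @bounded_cocycles R H 3].
pose comb (f : cochain R H 2) (a : 'I_m -> R) : cochain R H 3 :=
  coboundary f + \sum_i a i *: y i.
(* A k is closed by weak-* compactness: a generalized limit of primitives along a
   convergent sequence is a primitive of its limit. *)
pose A (k : nat) : set (('I_3 -> H) -> R) := [set z | exists f a,
  [/\ forall g, `|f g| <= k%:R, forall i, `|a i| <= k%:R & z = comb f a]].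
have ZD (u v : cochain R H 3) : Z u -> Z v -> Z (u + v) by exact: rpredD.
have Zcomb a : Z (\sum_i a i *: y i).
  by apply: rpred_sum => i _; exact: rpredZ.
have Zd (f : cochain R H 2) :
    (exists B, forall g, `|f g| <= B) -> Z (coboundary f).
  have [b ->] := cochain2P f => -[B fB].
  apply/bounded_cocyclesP; split=> [g|]; first exact: coboundary2_coboundary.
  exists (4 * B) => g; rewrite coboundary2E; apply: delta2_le => h h'.
  exact: (fB (word2 h h')).
have q_coboundary (f : cochain R H 2) : (exists B, forall g, `|f g| <= B) ->
    forall i, q (coboundary f) i = 0.
  move=> fb; apply/q0; first exact: Zd.
  by apply/asboolP; exists f => //; exact/Defs.bounded_funP.
have q_comb (f : cochain R H 2) a : (exists B, forall g, `|f g| <= B) ->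
    forall i, q (comb f a) i = a i.
  move=> fb i; rewrite /comb -[coboundary f]scale1r.
  rewrite qlin//; [|exact: Zd|exact: Zcomb].
  by rewrite q_coboundary// mulr0 add0r qy.
have Zc : uniformly_closed Z.
  move=> s sZ; apply/bounded_cocyclesP; split; last first.
    have [//|u /bounded_cocyclesP[_ [M uM]] us] := sZ 1.
    by exists (M + 1) => g; have := us g; have := uM g; rewrite !ler_norml; lra.
  have [u [uZ us]] := uniform_closure_seq sZ => g.
  have -> : s = fun g => L (fun j => u j g).
    by apply/funext => h; rewrite (glimP Llim (us h)).
  rewrite (glim_coboundary Llim) -[RHS](glim_cst Llim 0); congr L.
  by apply/funext => j; have /bounded_cocyclesP[->] := uZ j.
have combE f a g : comb f a g = coboundary f g + \sum_i a i * y i g.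
  by rewrite /comb fctE fct_sumE.
have Ac k : uniformly_closed (A k).
  move=> s /uniform_closure_seq[u [uA us]].
  have [f fP] := choice uA; have [a aP] := choice fP.
  exists (fun h => L (fun j => f j h)), (fun i => L (fun j => a j i)); split.
  - by move=> g; apply: (glim_le Llim) => j; have [+ _ _] := aP j.
  - by move=> i; apply: (glim_le Llim) => j; have [_ + _] := aP j.
  - apply/funext => g; rewrite combE (glim_coboundary Llim).
    under eq_bigr => i _ do rewrite mulrC -(glimZ Llim).
    rewrite -(glim_sum Llim) -(glimD Llim) -(glimP Llim (us g)).
    congr L; apply/funext => j; have [_ _ ->] := aP j.
    by rewrite combE; congr (_ + _); apply: eq_bigr => i _; rewrite mulrC.
have AZ z : Z z -> exists k, A k z.
  (* Removing the representative with the same coordinates leaves a bounded coboundary. *)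
  move=> Zz; pose w : cochain R H 3 := z - \sum_i q z i *: y i.
  have Zw : Z w by apply: rpredB => //; exact: Zcomb.
  have : w \in @bounded_coboundaries R H 3.
    apply/q0 => // i.
    have := qlin 1 w (\sum_i q z i *: y i) i Zw (Zcomb _).
    by rewrite qy scale1r subrK mul1r => /(congr1 (fun t => t - q z i));
      rewrite subrr addrK.
  move=> /asboolP[f /Defs.bounded_funP fb wE].
  have [M fM] := fb.
  have M0 : 0 <= M by exact: le_trans (normr_ge0 _) (fM (fun=> 1%g)).
  have S0 : 0 <= \sum_i `|q z i| by apply: sumr_ge0.
  have [k kM] : exists k : nat, M + \sum_i `|q z i| <= k%:R.
    exists (Num.bound (M + \sum_i `|q z i|)); apply: ltW.
    exact: archi_boundP (addr_ge0 M0 S0).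
  exists k, f, (q z); split=> [g|i|].
  - by rewrite (le_trans (fM g))// (le_trans _ kM)// lerDl.
  - rewrite (le_trans _ kM)// (bigD1 i)//= addrCA lerDl addr_ge0//.
    exact: sumr_ge0.
  - by rewrite /comb -wE subrK.
have AB j k u v : A j u -> A k v -> A (j + k)%N (fun x => u x - v x).
  move=> [f [a [fj aj ->]]] [f' [a' [fk ak ->]]].
  exists (f - f'), (fun i => a i - a' i); split.
  - by move=> g; rewrite natrD (le_trans (ler_normB _ _))// lerD.
  - by move=> g; rewrite natrD (le_trans (ler_normB _ _))// lerD.
  - rewrite /comb raddfB/=; under [in RHS]eq_bigr do rewrite scalerBl.
    by rewrite sumrB addrACA -opprD.
have [k [r [r0 Ar]]] := uniform_baire ZD (rpred0 _) Zc Ac AZ AB.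
exists (k%:R / r) => [|f M fb fM]; first by rewrite divr_ge0// ltW.
(* The rescaling by [r / M] below needs [M] positive; otherwise [coboundary f] vanishes and 0 is a
   primitive. *)
have [M0|M0] := leP M 0.
  have df : coboundary f = 0.
    by apply/funext => g; apply/eqP; rewrite -normr_le0 (le_trans (fM g)).
  exists 0; split=> [g|]; last by rewrite raddf0 df.
  have -> : M = 0.
    by apply/eqP; rewrite eq_le M0 (le_trans _ (fM (fun=> 1%g))).
  by rewrite normr0 mulr0.
have M0' : M != 0 by rewrite gt_eqF.
have r0' : r != 0 by rewrite gt_eqF.
have [|g|f' [a [f'k _ fE]]] := Ar ((r / M) *: coboundary f).
- exact/rpredZ/Zd.
- rewrite fctE normrM ger0_norm ?divr_ge0 ?(ltW r0) ?(ltW M0)// mulrAC.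
  by rewrite ler_pdivrMr// ler_wpM2l// (ltW r0).
- have f'b : exists B, forall g, `|f' g| <= B by exists k%:R.
  (* The [a i] are the coordinates of a class that is the coboundary of a bounded cochain. *)
  have a0 i : a i = 0.
    rewrite -(q_comb f' a f'b) -fE -linearZ; apply: q_coboundary.
    have [B fB] := fb; exists (r / M * B) => g.
    have rM0 : 0 <= r / M by rewrite divr_ge0 ?(ltW r0) ?(ltW M0).
    by rewrite fctE normrM ger0_norm// ler_wpM2l.
  exists ((M / r) *: f'); split=> [g|].
    rewrite fctE normrM ger0_norm ?divr_ge0 ?(ltW r0) ?(ltW M0)//.
    rewrite [X in _ <= X]mulrAC [k%:R * M]mulrC [X in _ <= X]mulrAC ler_wpM2l//.
    by rewrite divr_ge0// ltW.
  have -> : coboundary f = (M / r) *: ((r / M) *: coboundary f).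
    rewrite scalerA; have -> : M / r * (r / M) = 1 by field; apply/andP.
    by rewrite scale1r.
  rewrite fE linearZ/= /comb big1 ?addr0// => i _.
  by rewrite a0 scale0r.
Qed.

Lemma bounded_primitive2 (R : realType) (H : groupType) :
    finite_dimensional (bounded_cohomology R H 3) ->
  exists2 C : R, 0 <= C & forall (b : H -> H -> R) (M : R),
    (exists B, forall x y, `|b x y| <= B) ->
    (forall x y z, `|delta2 b x y z| <= M) ->
    exists b' : H -> H -> R, (forall x y, `|b' x y| <= C * M) /\
      forall x y z, delta2 b' x y z = delta2 b x y z.
Proof.
move=> /bounded_primitive[C C0 hC]; exists C => // b M [B bB] bM.
have [||f] := hC (cochain2_of b) M; first by exists B => g; exact: bB.
  by move=> g; rewrite coboundary2E.
have [b' ->] := cochain2P f => -[b'C bE]; exists b'; split=> [x y|x y z].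
  exact: (b'C (word2 x y)).
by rewrite -!coboundary2_word3 bE.
Qed.

(** Take a family in [S] of maximal rank: a vector outside its span could be appended and would
    raise the rank. *)
Lemma finite_spanning_family (K : fieldType) (T : Type) (m : nat) (S : set T)
    (q : T -> 'rV[K]_m) :
  exists n (y : 'I_n -> T), (forall i, S (y i)) /\
    forall z, S z -> exists a, q z = \sum_i a i *: q (y i).
Proof.
pose P r := `[< exists n (y : 'I_n -> T),
  (forall i, S (y i)) /\ \rank (\matrix_i q (y i)) = r >].
have exP : exists r, P r.
  exists 0%N; apply/asboolP; exists 0%N.
  have y0 : 'I_0 -> T by case.
  by exists y0; split=> [[]//|]; apply/eqP; rewrite -leqn0 rank_leq_row.
have ubP r : P r -> (r <= m)%N.
  by move=> /asboolP[n [y [_ <-]]]; exact: rank_leq_col.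
case: (ex_maxnP exP ubP) => r /asboolP[n [y [Sy yr]]] rmax.
exists n, y; split=> // z Sz.
set A := (\matrix_i q (y i)) in yr.
have [/submxP[D ->]|zA] := boolP (q z <= A)%MS.
  exists (D 0); rewrite mulmx_sum_row; apply: eq_bigr => i _.
  by rewrite rowK.
pose y' (i : 'I_(n + 1)) := if fintype.split i is inl j then y j else z.
have y'E : \matrix_i q (y' i) = col_mx A (q z).
  apply/row_matrixP => i; rewrite rowK /y'; case: (split_ordP i) => j ->.
    by rewrite rowKu rowK.
  by rewrite rowKd ord1 row_id.
have : P (\rank (col_mx A (q z))).
  apply/asboolP; exists (n + 1)%N, y'; split; last by rewrite y'E.
  by move=> i; rewrite /y'; case: (fintype.split i).
have /andP[AA' zA'] : (A <= col_mx A (q z))%MS && (q z <= col_mx A (q z))%MS.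
  by rewrite -col_mx_sub.
move=> /rmax; rewrite -yr leqNgt => /negP[].
by rewrite (ltn_leqif (mxrank_leqif_sup AA')) col_mx_sub submx_refl.
Qed.

(** The [c i] span the image of bounded in ordinary cohomology; accordingly [w] may be unbounded. *)
Lemma bounded_cocycles_finite (R : realType) (H : groupType) :
    finite_dimensional (bounded_cohomology R H 2) \/
    finite_dimensional (cohomology R H 2) ->
  exists m (c : 'I_m -> H -> H -> R),
    (forall i, exists B, forall x y, `|c i x y| <= B) /\
    forall e : H -> H -> R, (exists B, forall x y, `|e x y| <= B) ->
      (forall x y z, delta2 e x y z = 0) ->
      exists (t : 'I_m -> R) (w : H -> R),
        forall x y, e x y = \sum_i t i * c i x y + delta1 w x y.
Proof.
move=> fin.
suff [m [y [yb yP]]] : exists m (y : 'I_m -> cochain R H 2),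
    (forall i, exists B, forall g, `|y i g| <= B) /\
    forall e : cochain R H 2, e \in @bounded_cocycles R H 2 ->
      exists a, exists f : cochain R H 1, e = \sum_i a i *: y i + coboundary f.
  exists m, (fun i x x' => y i (word2 x x')); split=> [i|e [B eB] e0].
    by have [B yB] := yb i; exists B => x x'; exact: yB.
  have [|a [f]] := yP (cochain2_of e).
    apply/bounded_cocyclesP; split=> [g|]; first by rewrite coboundary2E e0.
    by exists B => g; exact: eB.
  have [w ->] := cochain1P f => eE; exists a, w => x x'.
  have := congr1 (fun h : cochain R H 2 => h (word2 x x')) eE.
  by rewrite fctE fct_sumE coboundary1E.
case: fin => /subquotient_coordinates[m [q [y [yZ qlin q0 qy]]]].
  exists m, y; split=> [i|e eZ]; first by have /bounded_cocyclesP[] := yZ i.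
  pose r := \sum_i q e i *: y i.
  have rZ : r \in @bounded_cocycles R H 2.
    by apply: rpred_sum => i _; exact: rpredZ.
  have : e - r \in @bounded_coboundaries R H 2.
    apply/q0 => [|i]; first exact: rpredB.
    by rewrite addrC -scaleN1r qlin// qy mulN1r addNr.
  move=> /asboolP[f _ /eqP]; rewrite subr_eq addrC => /eqP eE.
  by exists (q e), f.
(* Representatives of a basis of ordinary cohomology may be unbounded; bounded cocycles spanning the
   same classes as [Z] are used instead. *)
pose Z : set (cochain R H 2) := [set z | z \in @bounded_cocycles R H 2].
have [n [z [zZ zP]]] := finite_spanning_family Z (fun c => \row_i q c i).
have sub_cocycles c : Z c -> c \in @cocycles R H 2 by case/andP.
exists n, z; split=> [i|e eZ]; first by have /bounded_cocyclesP[] := zZ i.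
have [a ea] := zP e eZ.
have qE (r : seq 'I_n) i : q (\sum_(j <- r) a j *: z j) i =
    \sum_(j <- r) a j * q (z j) i.
  have q00 : q 0 i = 0 by apply: (proj1 (q0 0 _)); exact: rpred0.
  elim: r => [|j r IHr]; first by rewrite !big_nil.
  rewrite !big_cons qlin ?IHr//; first exact/sub_cocycles/zZ.
  by apply: rpred_sum => k _; apply/rpredZ/sub_cocycles/zZ.
pose r := \sum_i a i *: z i.
have rZ : r \in @cocycles R H 2.
  by apply: rpred_sum => i _; apply/rpredZ/sub_cocycles/zZ.
have : e - r \in @coboundaries R H 2.
  apply/q0 => [|i]; first by apply: rpredB => //; exact: sub_cocycles.
  rewrite addrC -scaleN1r qlin//; last exact: sub_cocycles.
  rewrite qE mulN1r; have /rowP/(_ i) := ea; rewrite mxE summxE => ->.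
  by rewrite addrC; apply/eqP; rewrite subr_eq0;
    apply/eqP/eq_bigr => j _; rewrite !mxE.
move=> /asboolP[f /eqP]; rewrite subr_eq addrC => /eqP eE.
by exists a, f.
Qed.
(** * Quasimorphisms *)

Section Homogeneity.
Variables (R : realType) (H : groupType).
Implicit Type f : H -> R^o.

Lemma quasimorphism_delta1 f x y : quasimorphism f ->
  `|delta1 f x y| <= fine (defect f).
Proof.
move=> fq; have := quasimorphism_bound x y fq.
by rewrite /delta1 -normrN opprB opprB addrCA addrA.
Qed.

Lemma homogeneousV f x : homogeneous f -> f x^-1%g = - f x.
Proof.
move=> fh; have f1 : f 1%g = 0 by rewrite -(expg0 x) homogeneousX// mul0r.
apply/eqP; rewrite -addr_eq0 -f1 -(mulVg x) (fh x)//.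
  by exists 1%N; right; rewrite expg1.
by exists 1%N; left; rewrite expg1.
Qed.

Lemma cyclic_subgroup_commute (h x y : H) :
  cyclic_subgroup h x -> cyclic_subgroup h y -> commute x y.
Proof.
have hX z : cyclic_subgroup h z -> commute h z.
  by move=> [n [->|->]]; [|apply: commuteV]; exact: commuteX.
move=> [n [->|->]] /hX hy; apply/commute_sym; last apply: commuteV.
  exact/commuteX/commute_sym.
exact/commuteX/commute_sym.
Qed.

(** Otherwise [f] would grow linearly along the powers of [x]. *)
Lemma bounded_homogeneous_eq0 f B :
  homogeneous f -> (forall x, `|f x| <= B) -> forall x, f x = 0.
Proof.
move=> fh fB x; apply/eqP; rewrite -normr_le0 leNgt; apply/negP => fx0.
have B0 : 0 <= B / `|f x| by rewrite divr_ge0// (le_trans _ (fB x)).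
have := archi_boundP B0; set n := Num.bound _.
rewrite ltr_pdivrMr// ltNge -[n%:R]ger0_norm// -normrM -homogeneousX//.
by rewrite fB.
Qed.

Lemma quasimorphism_expg (u : H -> R) D x n :
  (forall x y, `|delta1 u x y| <= D) ->
  `|u (x ^+ n.+1)%g - n.+1%:R * u x| <= n%:R * D.
Proof.
move=> uD; elim: n => [|n IHn].
  by rewrite expg1 mul1r subrr normr0 mul0r.
have := uD x (x ^+ n.+1)%g; move: IHn; rewrite /delta1 -expgS !ler_norml.
rewrite -(natr1 n.+1) -(natr1 n); set p := u _; set q := u (_ ^+ n.+2)%g.
lra.
Qed.

(** A generalized limit of u(x^n)/n avoids proving convergence. Elements of a cyclic subgroup
    commute, so (xy)^n = x^n y^n and the error D/n disappears in the limit. *)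
Lemma homogenization (u : H -> R) D : (forall x y, `|delta1 u x y| <= D) ->
  exists f, [/\ quasimorphism f, homogeneous f & forall x, `|u x - f x| <= D].
Proof.
move=> uD; have [L Llim] := generalized_limit_exists R.
pose f (x : H) : R^o := L (fun n => u (x ^+ n.+1)%g / n.+1%:R).
have uf x : `|u x - f x| <= D.
  rewrite -(glim_cst Llim (u x)) -(glimB Llim); apply: (glim_le Llim) => n.
  have n0 : 0 < n.+1%:R :> R by [].
  have -> : u x - u (x ^+ n.+1)%g / n.+1%:R =
      - (u (x ^+ n.+1)%g - n.+1%:R * u x) / n.+1%:R.
    by field; rewrite gt_eqF.
  rewrite normrM normrN normfV [`|n.+1%:R|]ger0_norm// ler_pdivrMr//.
  rewrite (le_trans (quasimorphism_expg _ _ uD))// mulrC ler_wpM2l ?ler_nat//.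
  exact: le_trans (normr_ge0 _) (uD x x).
exists f; split=> //.
  apply: (proj1 (@bound_quasimorphism _ _ _ (4 * D) _)) => x y.
  have := uf x; have := uf y; have := uf (x * y)%g; have := uD x y.
  rewrite /delta1 !ler_norml; lra.
move=> h x y hx hy; have xy := cyclic_subgroup_commute hx hy.
rewrite /f -(glimD Llim); apply: (glim_eq Llim).
apply: (@cvg_harmonic_bound _ _ _ D) => n; rewrite subr0.
rewrite -mulrDl -mulrBl normrM normfV [`|n.+1%:R|]ger0_norm// ler_wpM2r//.
have := uD (x ^+ n.+1)%g (y ^+ n.+1)%g.
by rewrite -normrN opprB /delta1 expgMn.
Qed.

End Homogeneity.

(** * Transgression from N to G / N *)

Section Extension.
Variables (R : realType) (G : groupType) (N : normalSubgroup G).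
Implicit Types (f : subgroup N -> R^o) (g h : G) (n : subgroup N).

Local Notation Q := (quotient_group N).
Local Notation cl := (\pi_Q).

Definition coset_shift g : subgroup N :=
  Sub (g^-1 * repr (cl g))%g (coset_repr N g).

(* Up to a bounded error, the function with extend f (s n) = f n for s in the
   chosen transversal. *)
Definition extend f g : R := - f (coset_shift g).

(** The cochain alpha_f: the coboundary of the extension, read on the transversal. *)
Definition transgression f (c c' : Q) : R :=
  delta1 (extend f) (repr c) (repr c').

Lemma val_coset_shift g : val (coset_shift g) = (g^-1 * repr (cl g))%g.
Proof. by []. Qed.

Lemma val_subgroup_conj n g : val (subgroup_conj n g) = (val n ^ g)%g.
Proof. by []. Qed.

Lemma repr_coset_shift g : repr (cl g) = (g * val (coset_shift g))%g.
Proof. by rewrite val_coset_shift mulVKg. Qed.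

Lemma pi_mulN g n : cl (g * val n)%g = cl g.
Proof. by apply/esym/coset_eqP; rewrite mulKg; exact: valP. Qed.

Section Defect.
Variables (f : subgroup N -> R^o) (D : R).
Hypotheses (fD : forall x y, `|delta1 f x y| <= D)
  (fV : forall x, f x^-1%g = - f x) (fi : conj_invariant f).

(** The shift of [g n] is [n^-1] times the shift of [g], so a single defect of [f] occurs. *)
Lemma extend_mulr g n : `|extend f (g * val n)%g - extend f g - f n| <= D.
Proof.
have -> : extend f (g * val n)%g = - f (n^-1 * coset_shift g)%g.
  congr (- f _); apply: val_inj; rewrite gmulfM gmulfV.
  rewrite !val_coset_shift pi_mulN invgM.
  by rewrite mulgA.
have := fD n^-1%g (coset_shift g).
by rewrite /delta1 /extend fV !ler_norml; lra.
Qed.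

Lemma mulNg_conj g n : (val n * g = g * val (subgroup_conj n g))%g.
Proof. by rewrite val_subgroup_conj conjgE mulVKg. Qed.

Lemma extend_mull g n : `|extend f (val n * g)%g - extend f g - f n| <= D.
Proof. by rewrite mulNg_conj -(fi n g) extend_mulr. Qed.

(** The representatives are [g m] and [h n]. Moving [m] to the far left conjugates it, which [f]
    does not see; the values at [m] and [n] cancel, leaving four errors [D]. *)
Lemma delta1_extend g h :
  `|delta1 (extend f) g h - transgression f (cl g) (cl h)| <= 4 * D.
Proof.
rewrite /transgression !repr_coset_shift.
set m := coset_shift g; set n := coset_shift h.
pose m' := subgroup_conj m g^-1%g.
have E : (g * val m * (h * val n) = val m' * (g * h * val n))%g.
  by rewrite val_subgroup_conj conjgE invgK -!mulgA mulKg.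
have := extend_mulr g m; have := extend_mulr h n.
have := extend_mull (g * h * val n)%g m'; have := extend_mulr (g * h)%g n.
rewrite /delta1 E fi !ler_norml; lra.
Qed.

(** Each of the four terms is within [4 * D] of the corresponding term of
    [delta2 (delta1 (extend f))], which is 0. *)
Lemma delta2_transgression c c' c'' :
  `|delta2 (transgression f) c c' c''| <= 16 * D.
Proof.
rewrite -[c]reprK -[c']reprK -[c'']reprK.
move: (repr c) (repr c') (repr c'') => g h k.
have := delta2_delta1 (extend f) g h k.
rewrite /delta2 -!pi_mulg.
have := delta1_extend h k; have := delta1_extend (g * h)%g k.
have := delta1_extend g (h * k)%g; have := delta1_extend g h.
rewrite !ler_norml; lra.
Qed.

End Defect.
End Extension.

Section LimitsOfCoboundaries.
Variables (R : realType) (H : groupType) (L : (nat -> R) -> R).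
Hypothesis Llim : generalized_limit L.

Lemma glim_delta1 (u : nat -> H -> R) x y :
  delta1 (fun x => L (fun j => u j x)) x y = L (fun j => delta1 (u j) x y).
Proof. by rewrite /delta1 (glimB Llim) (glimD Llim). Qed.

Lemma glim_delta2 (b : nat -> H -> H -> R) x y z :
  delta2 (fun x y => L (fun j => b j x y)) x y z =
  L (fun j => delta2 (b j) x y z).
Proof. by rewrite /delta2 (glimB Llim) (glimD Llim) (glimB Llim). Qed.

End LimitsOfCoboundaries.

(** * Restrictions of quasimorphisms and their limits *)

Section Image.
Variables (R : realType) (G : groupType) (N : normalSubgroup G).

Local Notation Q := (quotient_group N).
Local Notation cl := (\pi_Q).

Lemma extendB (f f' : subgroup N -> R^o) g :
  extend (f - f') g = extend f g - extend f' g.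
Proof. by rewrite /extend !fctE opprB opprK addrC. Qed.

Lemma transgressionB (f f' : subgroup N -> R^o) c c' :
  transgression (f - f') c c' = transgression f c c' - transgression f' c c'.
Proof. by rewrite /transgression /delta1 !extendB; ring. Qed.

(** On [G], [extend] of the restriction differs from [p] by [u] up to a defect, so adding [delta1 u]
    gives [delta1] of [p] up to a bounded error. *)
Lemma transgression_restrict (p : Defs.subspace (@hqm_pred R G)) :
  exists (b : Q -> Q -> R) (u : Q -> R),
    (exists B, forall c c', `|b c c'| <= B) /\
    forall c c', transgression (val (hqm_restrict N p)) c c' =
      b c c' - delta1 u c c'.
Proof.
set f := val (hqm_restrict N p); have /asboolP[pq ph] := valP p.
pose u (c : Q) := val p (repr c).
exists (fun c c' => transgression f c c' + delta1 u c c'), u.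
split=> [|c c']; last by rewrite addrK.
set D := fine (defect (val p)).
have uD g : `|val p g - extend f g - u (cl g)| <= D.
  have := quasimorphism_delta1 g (val (coset_shift N g)) pq.
  by rewrite /delta1 -repr_coset_shift /extend opprK.
exists (4 * D) => c c'.
have := quasimorphism_delta1 (repr c) (repr c') pq.
have := uD (repr c); have := uD (repr c'); have := uD (repr c * repr c')%g.
rewrite pi_mulg !reprK /transgression /delta1 -/D !ler_norml; lra.
Qed.

Lemma restriction_of_cobounding (f : subgroup N -> R^o) (v : G -> R)
    (z : Q -> Q -> R) B :
    f \in @inv_hqm_pred R G N ->
    (forall g h, delta1 v g h = z (cl g) (cl h)) ->
    (forall g h, `|delta1 (extend f) g h - delta1 v g h| <= B) ->
  exists p : Defs.subspace (@hqm_pred R G),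
    f - val (hqm_restrict N p) \in @inv_hom_pred R G N.
Proof.
move=> /andP[/asboolP[fq fh] /asboolP fi] vz vB.
pose w g := extend f g - v g.
have [|p0 [pq ph wp]] := @homogenization _ _ w B.
  move=> g h; have := vB g h; congr (`|_| <= _); rewrite /w /delta1; ring.
have pQ : p0 \in @hqm_pred R G by exact/asboolP.
pose p : Defs.subspace (@hqm_pred R G) := Sub p0 pQ.
exists p.
pose k (n : subgroup N) : R^o := v (val n) - v 1%g.
have cl1 (n : subgroup N) : cl (val n) = cl 1%g.
  by rewrite -(mul1g (val n)) pi_mulN.
(* [delta1 v] sees only cosets, so [n] may be replaced by 1 in it. *)
have vr g (n : subgroup N) : v (g * val n)%g = v g + k n.
  by have := vz g 1%g; rewrite -(cl1 n) -vz /delta1 mulg1 /k; lra.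
have vl g (n : subgroup N) : v (val n * g)%g = v g + k n.
  by have := vz 1%g g; rewrite -(cl1 n) -vz /delta1 mul1g /k; lra.
have kD (m n : subgroup N) : k (m * n)%g = k m + k n.
  by rewrite {1}/k gmulfM vr /k; ring.
have ki : conj_invariant k.
  by move=> n g; have := vr g (subgroup_conj n g); rewrite -mulNg_conj vl; lra.
suff -> : f - val (hqm_restrict N p) = k.
  by apply/andP; split; exact/asboolP.
have [_ rh _] := inv_hqmP (hqm_restrict N p).
apply/eqP; rewrite -subr_eq0; apply/eqP/funext => n.
set D := fine (defect f).
(* [D] comes from extending [f], [B] from homogenizing [w], and the last term from normalizing at
   1. *)
apply: (@bounded_homogeneous_eq0 _ _ _ (D + B + `|v 1%g - extend f 1%g|)).
  move=> h x y hx hy; rewrite !fctE (fh h)// (rh h)// kD; ring.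
move=> {}n.
have fD x y := quasimorphism_delta1 x y fq.
have := extend_mulr fD (fun x => homogeneousV x fh) 1%g n.
have := wp (val n); rewrite /w mul1g.
have := ler_norm (v 1%g - extend f 1%g).
have := ler_norm (- (v 1%g - extend f 1%g)).
rewrite normrN -/D !fctE /k /=; set a := `|_ - extend f 1%g|.
rewrite !ler_norml; lra.
Qed.

Lemma limit_of_restrictions (f : subgroup N -> R^o) :
    finite_dimensional (bounded_cohomology R Q 3) ->
    finite_dimensional (bounded_cohomology R Q 2) \/
    finite_dimensional (cohomology R Q 2) ->
    f \in @inv_hqm_pred R G N ->
    (forall e, 0 < e -> exists p : Defs.subspace (@hqm_pred R G),
      fine (defect (f - val (hqm_restrict N p))) <= e) ->
  exists p : Defs.subspace (@hqm_pred R G),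
    f - val (hqm_restrict N p) \in @inv_hom_pred R G N.
Proof.
move=> /bounded_primitive2[C C0 primC].
move=> /bounded_cocycles_finite[m [c [cb cP]]] fQ fcl.
have [L Llim] := generalized_limit_exists R.
have /choice[p pP] : forall j : nat, exists p : Defs.subspace (@hqm_pred R G),
    fine (defect (f - val (hqm_restrict N p))) <= j.+1%:R^-1.
  by move=> j; apply: fcl; rewrite invr_gt0.
pose r j := f - val (hqm_restrict N (p j)).
have rQ j : r j \in @inv_hqm_pred R G N.
  by apply: rpredB => //; exact: valP.
have rD j x y : `|delta1 (r j) x y| <= j.+1%:R^-1.
  have /andP[/asboolP[rq _] _] := rQ j.
  exact: le_trans (quasimorphism_delta1 x y rq) (pP j).
have rV j x : r j x^-1%g = - r j x.
  by have /andP[/asboolP[_ rh] _] := rQ j; exact: homogeneousV.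
have ri j : conj_invariant (r j) by have /andP[_ /asboolP] := rQ j.
have /andP[/asboolP[fq fh] /asboolP fi] := fQ.
set D := fine (defect f).
have fD x y : `|delta1 f x y| <= D by exact: quasimorphism_delta1.
have fV x : f x^-1%g = - f x by exact: homogeneousV.
have /choice[b /choice[u buP]] := fun j => transgression_restrict (p j).
have bb j : exists B, forall x y, `|b j x y| <= B by have [] := buP j.
have fE j x y : transgression f x y =
    b j x y - delta1 (u j) x y + transgression (r j) x y.
  by rewrite transgressionB; have [_ ->] := buP j; ring.
have d2f j x y z : delta2 (transgression f) x y z =
    delta2 (b j) x y z + delta2 (transgression (r j)) x y z.
  have := delta2_delta1 (u j) x y z.
  by rewrite /delta2 !(fE j); lra.
have d2r j x y z : `|delta2 (transgression (r j)) x y z| <= 16 * j.+1%:R^-1.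
  exact: delta2_transgression.
have inv1 j : (j.+1%:R^-1 : R) <= 1 by rewrite invf_le1// ler1n.
(* [delta2 (b j)] is at most [16 * D + 16 / j.+1]. The bound [16 * D + 16] is uniform in [j], so the
   generalized limit [b0] of the [b' j] is bounded. *)
have /choice[b' b'P] : forall j, exists b' : Q -> Q -> R,
    (forall x y, `|b' x y| <= C * (16 * D + 16)) /\
    forall x y z, delta2 b' x y z = delta2 (b j) x y z.
  move=> j; apply: primC => // x y z.
  have := d2f j x y z; have := d2r j x y z; have := inv1 j.
  have := delta2_transgression fD fV fi x y z.
  move: (_^-1) => e; rewrite !ler_norml; lra.
pose b0 x y := L (fun j => b' j x y).
have b0b x y : `|b0 x y| <= C * (16 * D + 16).
  by apply: (glim_le Llim) => j; have [] := b'P j.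
have d2b0 x y z : delta2 b0 x y z = delta2 (transgression f) x y z.
  rewrite (glim_delta2 Llim) -[RHS](glim_cst Llim); apply: (glim_eq Llim).
  apply: (@cvg_harmonic_bound _ _ _ 16) => j; have [_ ->] := b'P j.
  by rewrite (d2f j) subr0 opprD addrA subrr sub0r normrN.
(* [b0 - b j] has a coboundary of order [1 / j.+1]; the linear control of primitives gives an
   equally small [s j] that makes [b j + s j - b0] a bounded cocycle. *)
have /choice[s sP] : forall j, exists s : Q -> Q -> R,
    (forall x y, `|s x y| <= C * (16 * j.+1%:R^-1)) /\
    forall x y z, delta2 s x y z = delta2 (transgression (r j)) x y z.
  move=> j; have [B bB] := bb j.
  have dE x y z : delta2 (fun x y => b0 x y - b j x y) x y z =
      delta2 (transgression (r j)) x y z.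
    by have := d2b0 x y z; rewrite (d2f j) /delta2; lra.
  have [||s [sC sE]] := primC (fun x y => b0 x y - b j x y) (16 * j.+1%:R^-1).
  - exists (C * (16 * D + 16) + B) => x y.
    by rewrite (le_trans (ler_normB _ _))// lerD.
  - by move=> x y z; rewrite dE.
  - by exists s; split=> // x y z; rewrite sE dE.
have /choice[t /choice[w twP]] : forall j, exists (t : 'I_m -> R) (w : Q -> R),
    forall x y, b j x y + s j x y - b0 x y =
      \sum_i t i * c i x y + delta1 w x y.
  move=> j; apply: cP.
    have [B bB] := bb j; have [sC _] := sP j.
    exists (B + C * (16 * j.+1%:R^-1) + C * (16 * D + 16)) => x y.
    rewrite (le_trans (ler_normB _ _))// lerD//.
    by rewrite (le_trans (ler_normD _ _))// lerD.
  move=> x y z; have [_ sE] := sP j.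
  have := sE x y z; have := d2f j x y z; have := d2b0 x y z.
  by rewrite /delta2; lra.
(* Only after inflation to [G] is [transgression (r j)] nearly a coboundary, namely that of
   [extend (r j)]; this is why [v j] lives on [G]. *)
pose v j g := w j (cl g) - u j (cl g) + extend (r j) g.
pose z x y := transgression f x y - b0 x y - \sum_i L (t^~ i) * c i x y.
have zE g h : delta1 (fun g => L (v^~ g)) g h = z (cl g) (cl h).
  pose T j := \sum_i t j i * c i (cl g) (cl h).
  have TE : L T = \sum_i L (t^~ i) * c i (cl g) (cl h).
    rewrite /T (glim_sum Llim); apply: eq_bigr => i _.
    rewrite mulrC -(glimZ Llim); congr L.
    by apply/funext => j; rewrite mulrC.
  rewrite (glim_delta1 Llim) /z -TE.
  rewrite -[X in X - _ - _](glim_cst Llim) -[X in _ - X - _](glim_cst Llim).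
  rewrite -!(glimB Llim); apply: (glim_eq Llim).
  (* [C * 16] bounds the contribution of [s j], and 4 that of [delta1_extend] for [r j]. *)
  apply: (@cvg_harmonic_bound _ _ _ (C * 16 + 4)) => j.
  have vE : delta1 (v j) g h = delta1 (w j) (cl g) (cl h)
      - delta1 (u j) (cl g) (cl h) + delta1 (extend (r j)) g h.
    by rewrite /v /delta1 pi_mulg; ring.
  have wE : delta1 (w j) (cl g) (cl h) =
      b j (cl g) (cl h) + s j (cl g) (cl h) - b0 (cl g) (cl h) - T j.
    by rewrite twP addrC addKr.
  have -> : delta1 (v j) g h -
        (transgression f (cl g) (cl h) - b0 (cl g) (cl h) - T j) - 0 =
      s j (cl g) (cl h) +
      (delta1 (extend (r j)) g h - transgression (r j) (cl g) (cl h)).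
    by rewrite vE wE (fE j); ring.
  have [/(_ (cl g) (cl h)) sC _] := sP j.
  by rewrite (le_trans (ler_normD _ _))// mulrDl lerD// -?mulrA// delta1_extend.
have [M zM] : exists M, forall g h,
    `|delta1 (extend f) g h - z (cl g) (cl h)| <= M.
  have [K KP] := choice cb.
  exists (4 * D + C * (16 * D + 16) + \sum_i `|L (t^~ i)| * K i) => g h.
  rewrite /z; set S := \sum_(i < m) L _ * _.
  have SM : `|S| <= \sum_i `|L (t^~ i)| * K i.
    rewrite (le_trans (ler_norm_sum _ _ _))// ler_sum// => i _.
    by rewrite normrM ler_wpM2l.
  have -> : delta1 (extend f) g h -
        (transgression f (cl g) (cl h) - b0 (cl g) (cl h) - S) =
      delta1 (extend f) g h - transgression f (cl g) (cl h)
        + b0 (cl g) (cl h) + S by ring.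
  rewrite (le_trans (ler_normD _ _))// lerD// (le_trans (ler_normD _ _))//.
  by rewrite lerD// delta1_extend.
apply: (restriction_of_cobounding fQ zE (B := M)) => g h.
by rewrite zE.
Qed.

End Image.

Unset Implicit Arguments.

Theorem theorem2p4 (R : realType) (G : groupType) (N : normalSubgroup G)
    (H3b_fin : finite_dimensional (bounded_cohomology R (quotient_group N) 3))
    (H2_fin : finite_dimensional (bounded_cohomology R (quotient_group N) 2) \/
              finite_dimensional (cohomology R (quotient_group N) 2)) :
  closed (range (@ihat R G N)).
Proof.
move=> c clc; rewrite -[c]reprK.
have [e e0|p fp] := limit_of_restrictions H3b_fin H2_fin (valP (repr c)).
  (* The distance in the quotient is the defect of a difference of representatives. *)
  have [_ [[d _ <-] /= cd]] := clc _ (nbhsx_ballx c e e0).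
  exists (repr d); apply: ltW; move: cd.
  rewrite -ball_normE /= -[c in `|c - _|]reprK /ihat.
  set q := hqm_restrict N (repr d).
  have -> : \pi_(inv_hqm_mod_hom R N) (repr c) - \pi_(inv_hqm_mod_hom R N) q =
      \pi_(inv_hqm_mod_hom R N) (repr c - q).
    by rewrite -scaleN1r -pi_scale -pi_addq scaleN1r.
  by rewrite norm_inv_hqm_pi raddfB.
exists (\pi_(hqm_mod_hom R G) p) => //.
by rewrite ihat_pi; apply/esym/subquotient_eqP.
Qed.
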